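(* Let $G$ be a totally disconnected, locally compact group and let $H$ be a subgroup of $G$ with equicontinuously generated action on $G$ (by conjugation). Then there is an open subgroup $E$ of $G$ with the following properties: (i) $E$ is a reduced envelope for $H$ in $G$; (ii) $E = H\,\mathrm{Res}_G(H)\,U$, where $U$ is a compact open subgroup of $G$; (iii) $E$ is equicontinuously generated, and if $H$ is compactly generated then so is $E$; (iv) $\mathrm{Res}_G(H)$ is the intersection of all open normal subgroups of $E$, so in particular, $\mathrm{Res}_G(H)$ is normal in $E$; (v) $E/\mathrm{Res}_G(H)$ is a SIN group.
   Context: All topological groups are Hausdorff. A subgroup $H\le G$ (not necessarily closed) is regarded as acting on $G$ by conjugation. A set $S$ of automorphisms of $G$ is equicontinuous on $G$ (with respect to the right uniformity) if for every $x\in G$ and every identity neighbourhood $U$ there is a neighbourhood $W$ of $x$ with $s(x)\in U s(y)$ for all $s\in S$, $y\in W$. A group of automorphisms of $G$ is equicontinuously generated if it is generated by a symmetric ($S=S^{-1}$) set that is equicontinuous on $G$. A subgroup of $G$ has equicontinuously generated action on $G$ (or is called equicontinuously generated) if the group of automorphisms of $G$ that it induces by conjugation is equicontinuously generated. A subgroup is compactly generated if it is generated by a compact subset. $\mathrm{Res}_G(H)$ is the intersection of all open subgroups of $G$ normalized by $H$. A reduced envelope for $H$ in $G$ is an open subgroup $E$ of $G$ such that $H\le E$ and such that, given any open subgroup $E_2$ of $G$ such that $|H:H\cap E_2|$ is finite, then $|E:E\cap E_2|$ is finite. A SIN group is a topological group having a base of identity neighbourhoods that are invariant under conjugation. *)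

(* Defs.v *)
From HB Require Import structures.
From mathcomp Require Import all_boot all_order.
From mathcomp Require Import all_classical topology.

Set Implicit Arguments.
Unset Strict Implicit.
Unset Printing Implicit Defensive.

Local Open Scope classical_set_scope.
Local Open Scope group_scope.

(* The Hausdorff axiom is not part of the structure; it is stated separately
   with hausdorff_space. *)
HB.mixin Record isTopologicalGroup G & Topological G & Group G := {
  mulg_continuous : continuous (fun z : G * G => z.1 * z.2);
  invg_continuous : continuous (fun x : G => x^-1)
}.

#[short(type="topologicalGroupType")]
HB.structure Definition TopologicalGroup :=
  {G of Topological G & Group G & isTopologicalGroup G}.

Section Subgroups.
Context {G : groupType}.
Implicit Types (A B H K N : set G) (x : G).

Definition is_subgroup H := H 1 /\ forall x y, H x -> H y -> H (x / y).

Definition generated A : set G := smallest is_subgroup A.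

Definition set_mul A B : set G := [set x * y | x in A & y in B].

Definition lcoset x A : set G := [set x * y | y in A].

Definition lcosets H K : set (set G) := [set lcoset x K | x in H].

(* |H : K| is finite, for K a subgroup of H *)
Definition finite_index H K := finite_set (lcosets H K).

Definition normalizes H A := forall h, H h -> [set x ^ h | x in A] = A.

Definition is_normal_subgroup H N :=
  [/\ is_subgroup H, is_subgroup N, N `<=` H & normalizes H N].

End Subgroups.

Section TopologicalGroups.
Context {G : topologicalGroupType}.
Implicit Types (S A : set (G -> G)) (H E : set G).

Definition open_subgroup E := is_subgroup E /\ open E.

Definition is_automorphism (f : G -> G) :=
  [/\ {morph f : x y / x * y}, continuous f &
      exists g : G -> G, [/\ cancel f g, cancel g f & continuous g]].

Definition automorphism_group A :=
  [/\ A `<=` [set f | is_automorphism f], A id,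
      forall f g, A f -> A g -> A (f \o g) &
      forall f g, A f -> cancel f g -> cancel g f -> A g].

Definition generated_automorphism_group S : set (G -> G) :=
  smallest automorphism_group S.

Definition symmetric_automorphism_set S :=
  forall s, S s -> exists t, [/\ S t, cancel s t & cancel t s].

(* Equicontinuity with respect to the right uniformity of G. *)
Definition equicontinuous_automorphism_set S :=
  forall (x : G) (U : set G), nbhs 1 U ->
    exists2 W : set G, nbhs x W &
      forall s y, S s -> W y -> exists2 u, U u & s x = u * s y.

Definition equicontinuously_generated_automorphism_group A :=
  exists S, [/\ S `<=` [set f | is_automorphism f],
    symmetric_automorphism_set S, equicontinuous_automorphism_set S &
    A = generated_automorphism_group S].

Definition conjugation_action H : set (G -> G) :=
  [set (fun x => x ^ h) | h in H].

Definition equicontinuously_generated H :=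
  equicontinuously_generated_automorphism_group (conjugation_action H).

Definition compactly_generated H :=
  exists2 K : set G, compact K & H = generated K.

Definition Res H : set G :=
  \bigcap_(V in [set V | open_subgroup V /\ normalizes H V]) V.

Definition reduced_envelope H E :=
  [/\ open_subgroup E, H `<=` E &
      forall E2 : set G, open_subgroup E2 ->
        finite_index H (H `&` E2) -> finite_index E (E `&` E2)].

End TopologicalGroups.

(* Topological groups are taken to be Hausdorff here. *)
Definition SIN_group (G : topologicalGroupType) :=
  hausdorff_space G /\
  forall U : set G, nbhs 1 U ->
    exists V : set G, [/\ nbhs 1 V, V `<=` U & normalizes [set: G] V].

Section SubgroupTheory.
Context {G : groupType}.
Implicit Types (H N : set G).

Lemma is_subgroupV H x : is_subgroup H -> H x -> H x^-1.
Proof. by move=> [H1 HB] Hx; rewrite -[x^-1]mul1g; exact: HB. Qed.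

Lemma is_subgroupM H x y : is_subgroup H -> H x -> H y -> H (x * y).
Proof.
move=> sH Hx Hy; rewrite -[y]invgK.
by case: (sH) => _; apply=> //; exact: is_subgroupV.
Qed.

Lemma lcoset_refl N x : is_subgroup N -> lcoset x N x.
Proof. by move=> [N1 _]; exists 1 => //; rewrite mulg1. Qed.

Lemma lcoset_eq N x y : is_subgroup N -> lcoset x N y -> lcoset x N = lcoset y N.
Proof.
move=> sN [n Nn <-]; apply/seteqP; split=> _ [m Nm <-].
  exists (n^-1 * m); last by rewrite -mulgA mulVKg.
  by apply: is_subgroupM => //; exact: is_subgroupV.
by exists (n * m); rewrite ?mulgA//; exact: is_subgroupM.
Qed.

Section Normal.
Variables (E N : set G) (nEN : is_normal_subgroup E N).

Let sE : is_subgroup E. Proof. by case: nEN. Qed.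
Let sN : is_subgroup N. Proof. by case: nEN. Qed.
Let NE : N `<=` E. Proof. by case: nEN. Qed.

Lemma is_normal_subgroupJ x n : E x -> N n -> N (n ^ x).
Proof. by case: nEN => _ _ _ /[apply] {2}<- Nn; exists n. Qed.

Lemma set_mul_lcoset x y : E y ->
  set_mul (lcoset x N) (lcoset y N) = lcoset (x * y) N.
Proof.
move=> Ey; apply/seteqP; split.
  move=> _ [_ [n Nn <-]] [_ [m Nm <-]] <-; exists (n ^ y * m).
    by apply: is_subgroupM => //; exact: is_normal_subgroupJ.
  by rewrite /conjg !mulgA mulgK.
move=> _ [n Nn <-]; exists x; first exact: lcoset_refl.
by exists (y * n); [exists n|rewrite mulgA].
Qed.

Lemma image_invg_lcoset x : E x ->
  [set y^-1 | y in lcoset x N] = lcoset x^-1 N.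
Proof.
move=> Ex; apply/seteqP; split.
  move=> _ [_ [n Nn <-]] <-; exists (n^-1 ^ x^-1).
    by apply: is_normal_subgroupJ; exact: is_subgroupV.
  by rewrite /conjg invgK invgM !mulgA mulVg mul1g.
move=> _ [n Nn <-]; exists (n^-1 * x); last by rewrite invgM invgK.
exists (n^-1 ^ x); first by apply: is_normal_subgroupJ => //; exact: is_subgroupV.
by rewrite /conjg mulVKg.
Qed.

Lemma lcosets_sub C : lcosets E N C -> C `<=` E.
Proof. by move=> [x Ex <-] _ [n /NE En <-]; exact: is_subgroupM. Qed.

Lemma lcosetsE C x : lcosets E N C -> C x -> C = lcoset x N.
Proof. by move=> [y Ey <-]; exact: lcoset_eq. Qed.

Lemma lcosets_neq0 C : lcosets E N C -> exists2 x, E x & C x.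
Proof. by move=> [x Ex <-]; exists x => //; exact: lcoset_refl. Qed.

End Normal.
End SubgroupTheory.

(* The quotient group E / N: its elements are the cosets x N (x in E) as
   subsets of G, multiplied and inverted elementwise. The proof of normality is
   a parameter so that the group structure can be attached to the type. *)
Definition quotient_group (G : groupType) (E N : set G)
  (nEN : is_normal_subgroup E N) : Type := set_type (lcosets E N).

Section QuotientGroup.
Context {G : groupType} {E N : set G} (nEN : is_normal_subgroup E N).
Local Notation Q := (quotient_group nEN).

HB.instance Definition _ := SubType.copy Q (set_type (lcosets E N)).
HB.instance Definition _ := Choice.copy Q (set_type (lcosets E N)).

Let sE : is_subgroup E. Proof. by case: nEN. Qed.
Let sN : is_subgroup N. Proof. by case: nEN. Qed.

Lemma quotient_groupP (C : Q) : lcosets E N (val C).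
Proof. exact: set_mem (valP C). Qed.

Lemma lcoset1 : lcoset 1 N = N.
Proof.
by apply/seteqP; split=> [_ [n Nn <-]|n Nn]; [|exists n => //]; rewrite mul1g.
Qed.

Fact quotient_one_subproof : N \in lcosets E N.
Proof.
by apply/mem_set; exists 1; [case: sE|exact: lcoset1].
Qed.

Fact quotient_mul_subproof (C D : Q) : set_mul (val C) (val D) \in lcosets E N.
Proof.
apply/mem_set; case: (quotient_groupP C) (quotient_groupP D) => x Ex <- [y Ey <-].
by exists (x * y); [exact: is_subgroupM|rewrite (set_mul_lcoset nEN)].
Qed.

Fact quotient_inv_subproof (C : Q) : [set x^-1 | x in val C] \in lcosets E N.
Proof.
apply/mem_set; case: (quotient_groupP C) => x Ex <-.
by exists x^-1; [exact: is_subgroupV|rewrite (image_invg_lcoset nEN)].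
Qed.

Definition quotient_one : Q := Sub N quotient_one_subproof.
Definition quotient_mul (C D : Q) : Q :=
  Sub (set_mul (val C) (val D)) (quotient_mul_subproof C D).
Definition quotient_inv (C : Q) : Q :=
  Sub [set x^-1 | x in val C] (quotient_inv_subproof C).

Fact quotient_mulA : associative quotient_mul.
Proof.
move=> C D F; apply/val_inj; rewrite /= /set_mul; apply/seteqP; split.
  move=> _ [x Cx [_ [y Dy [z Fz <-]] <-]]; exists (x * y); first by exists x => //; exists y.
  by exists z => //; rewrite mulgA.
move=> _ [_ [x Cx [y Dy <-]] [z Fz <-]]; exists x => //.
by exists (y * z); [exists y => //; exists z|rewrite mulgA].
Qed.

Fact quotient_mul1g : left_id quotient_one quotient_mul.
Proof.
move=> C; apply/val_inj => /=; case: (quotient_groupP C) => x Ex <-.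
by rewrite -[X in set_mul X]lcoset1 (set_mul_lcoset nEN)// mul1g.
Qed.

Fact quotient_mulg1 : right_id quotient_one quotient_mul.
Proof.
move=> C; apply/val_inj => /=; case: (quotient_groupP C) => x Ex <-.
by rewrite -[X in set_mul _ X]lcoset1 (set_mul_lcoset nEN) ?mulg1//; case: sE.
Qed.

Fact quotient_mulVg : left_inverse quotient_one quotient_inv quotient_mul.
Proof.
move=> C; apply/val_inj => /=; case: (quotient_groupP C) => x Ex <-.
by rewrite (image_invg_lcoset nEN)// (set_mul_lcoset nEN)// mulVg lcoset1.
Qed.

Fact quotient_mulgV : right_inverse quotient_one quotient_inv quotient_mul.
Proof.
move=> C; apply/val_inj => /=; case: (quotient_groupP C) => x Ex <-.
rewrite (image_invg_lcoset nEN)// (set_mul_lcoset nEN) ?mulgV ?lcoset1//.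
exact: is_subgroupV.
Qed.

HB.instance Definition _ := isGroup.Build Q
  quotient_mulA quotient_mul1g quotient_mulg1 quotient_mulVg quotient_mulgV.

End QuotientGroup.

Section QuotientTopology.
Context {G : topologicalGroupType} {E N : set G} (nEN : is_normal_subgroup E N).
Local Notation Q := (quotient_group nEN).

Let sE : is_subgroup E. Proof. by case: nEN. Qed.
Let sN : is_subgroup N. Proof. by case: nEN. Qed.

(* The quotient topology of the subspace topology of E: the union of the cosets
   in W is the preimage of W in E. *)
Definition quotient_group_open (W : set Q) :=
  open ((\bigcup_(C in W) val C : set G) : set (subspace E)).

Let bigcup_sub (W : set Q) : \bigcup_(C in W) val C `<=` E.
Proof. by move=> x [C _]; exact: lcosets_sub nEN _ (quotient_groupP C) x. Qed.

Let quotient_group_openP (W : set Q) : quotient_group_open W <->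
  exists2 V : set G, open V & V `&` E = \bigcup_(C in W) val C.
Proof.
rewrite /quotient_group_open; split.
  by move=> /open_subspaceP[V oV VE]; exists V => //; rewrite VE;
    apply/setIidPl; exact: bigcup_sub.
move=> [V oV VE]; apply/open_subspaceP; exists V => //.
by rewrite VE; apply/esym/setIidPl; exact: bigcup_sub.
Qed.

Let val_eq (C D : Q) x : val C x -> val D x -> C = D.
Proof.
move=> Cx Dx; apply/val_inj.
rewrite (lcosetsE nEN (quotient_groupP C) Cx).
by rewrite (lcosetsE nEN (quotient_groupP D) Dx).
Qed.

Fact quotient_group_openT : quotient_group_open setT.
Proof.
apply/quotient_group_openP; exists setT; first exact: openT.
rewrite setTI; apply/seteqP; split=> [x Ex|]; last exact: bigcup_sub.
have cx : lcoset x N \in lcosets E N by apply/mem_set; exists x.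
by exists (Sub (lcoset x N) cx : Q) => //=; exact: lcoset_refl.
Qed.

Fact quotient_group_openI : setI_closed quotient_group_open.
Proof.
move=> A B oA oB; rewrite /quotient_group_open.
rewrite [X in open X](_ : _ = \bigcup_(C in A) val C `&` \bigcup_(C in B) val C).
  exact: openI.
apply/seteqP; split=> x; first by move=> [C [AC BC] Cx]; split; exists C.
by move=> [[C AC Cx] [D BD Dx]]; exists C => //; split=> //; rewrite (val_eq Cx Dx).
Qed.

Fact quotient_group_open_bigU (I : Type) (f : I -> set Q) :
  (forall i, quotient_group_open (f i)) -> quotient_group_open (\bigcup_i f i).
Proof.
move=> of_; rewrite /quotient_group_open.
rewrite [X in open X](_ : _ = \bigcup_i \bigcup_(C in f i) val C).
  by apply: bigcup_open => i _; exact: of_.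
apply/seteqP; split=> x; first by move=> [C [i _ fC] Cx]; exists i => //; exists C.
by move=> [i _ [C fC Cx]]; exists C => //; exists i.
Qed.

HB.instance Definition _ := isOpenTopological.Build Q
  quotient_group_openT quotient_group_openI quotient_group_open_bigU.

Let meet_open (O : set G) : open O ->
  open [set C : Q | exists2 y, val C y & O y].
Proof.
move=> oO; apply/quotient_group_openP.
exists (\bigcup_(n in N) [set y | O (y * n)]).
  apply: bigcup_open => n Nn.
  apply: (@open_comp _ _ (fun y : G => y * n)) => // y _.
  apply: (@continuous_comp _ _ _ (fun y => (y, n)) (fun z : G * G => z.1 * z.2)).
    by apply: cvg_pair => /=; [exact: cvg_id|exact: cvg_cst].
  exact: mulg_continuous.
apply/seteqP; split=> x.
  move=> [[n Nn Oxn] Ex].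
  have cx : lcoset x N \in lcosets E N by apply/mem_set; exists x.
  exists (Sub (lcoset x N) cx : Q); last exact: lcoset_refl.
  by exists (x * n) => //; exists n.
move=> [C [y Cy Oy] Cx]; split; last first.
  exact: (lcosets_sub nEN (quotient_groupP C)).
move: Cy; rewrite (lcosetsE nEN (quotient_groupP C) Cx) => -[n Nn xny].
by exists n => //=; rewrite xny.
Qed.

Let nbhs_meet (C : Q) x (A : set G) : val C x -> nbhs x A ->
  nbhs C [set D : Q | exists2 y, val D y & A y].
Proof.
move=> Cx; rewrite nbhsE => -[O [oO Ox] OA].
apply: filterS (open_nbhs_nbhs (conj (meet_open oO) _)); last by exists x.
by move=> D [y Dy /OA Ay]; exists y.
Qed.

Let nbhs_lift (C : Q) x (W : set Q) : val C x -> nbhs C W ->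
  exists2 V : set G, nbhs x V &
    forall y (D : Q), V y -> val D y -> W D.
Proof.
move=> Cx; rewrite nbhsE => -[W' [/quotient_group_openP[V oV VE] W'C] W'W].
exists V.
  apply: open_nbhs_nbhs; split=> //.
  suff: (V `&` E) x by case.
  by rewrite VE; exists C.
move=> y D Vy Dy; apply: W'W.
have Ey := lcosets_sub nEN (quotient_groupP D) Dy.
have : (V `&` E) y by [].
by rewrite VE => -[D' W'D' D'y]; rewrite (val_eq Dy D'y).
Qed.

Fact quotient_mulg_continuous : continuous (fun z : Q * Q => z.1 * z.2).
Proof.
move=> [C D] W /= nW.
have [x Ex Cx] := lcosets_neq0 nEN (quotient_groupP C).
have [y Ey Dy] := lcosets_neq0 nEN (quotient_groupP D).
have CDxy : val (C * D : Q) (x * y) by exists x => //; exists y.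
have [V nV VW] := nbhs_lift CDxy nW.
have [[A B] /= [nA nB] ABV] := @mulg_continuous G (x, y) V nV.
exists ([set D : Q | exists2 y, val D y & A y],
        [set D : Q | exists2 y, val D y & B y]).
  by split; [exact: nbhs_meet Cx nA|exact: nbhs_meet Dy nB].
move=> [C' D'] /= [[a C'a Aa] [b D'b Bb]].
apply: (VW (a * b)); first exact: (ABV (a, b)).
by exists a => //; exists b.
Qed.

Fact quotient_invg_continuous : continuous (fun x : Q => x^-1).
Proof.
move=> C W /= nW.
have [x Ex Cx] := lcosets_neq0 nEN (quotient_groupP C).
have CVx : val (C^-1 : Q) x^-1 by exists x.
have [V nV VW] := nbhs_lift CVx nW.
have nA := @invg_continuous G x V nV.
apply: filterS (nbhs_meet Cx nA) => D [y Dy Vy].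
by apply: (VW y^-1) => //; exists y.
Qed.

HB.instance Definition _ := isTopologicalGroup.Build Q
  quotient_mulg_continuous quotient_invg_continuous.

End QuotientTopology.

(* Main.v *)
Require Import Defs.
From HB Require Import structures.
From mathcomp Require Import all_boot all_order finmap.
From mathcomp Require Import all_classical topology.

Set Implicit Arguments.
Unset Strict Implicit.
Unset Printing Implicit Defensive.

Local Open Scope classical_set_scope.
Local Open Scope group_scope.

(** Write [R] for [Res H] and let [S] be a symmetric equicontinuous set of
    automorphisms generating the conjugation action of [H]. Given a compact open
    subgroup [U], equicontinuity provides a compact open subgroup [V] of [U] with
    [s V ⊆ U] for every [s] in [S]. As [R] is an intersection of open
    [H]-invariant subgroups, compactness provides one of them, [P], with
    [U ∩ P ⊆ R V]. Then [W = U ∩ P] satisfies [s (R W) ⊆ R W], so [R W] is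
    [H]-invariant. For every open [H]-invariant subgroup [P'], the intersection of
    the conjugates of [P'] by [R W] is again open and [H]-invariant, hence contains
    [R]; letting [P'] vary, [W] normalizes [R], and [E = H R W] is an open subgroup
    in which the intersection of [R W] with such a core is open and normal. *)

(** * Compactness and compact open sets in totally disconnected spaces *)

Section CompactSpaces.
Context {T : topologicalType}.
Implicit Types (A B K : set T) (F : set (set T)).

(** If every member of [F] met [K], the traces on [K] would generate a proper filter; its cluster
    point in [K] would lie in every member, as these are closed. *)
Lemma compact_bigcap_disjoint K F : compact K -> F !=set0 ->
  (forall A, F A -> closed A) ->
  (forall A B, F A -> F B -> exists2 C, F C & C `<=` A `&` B) ->
  (forall x, K x -> exists2 A, F A & ~ A x) ->
  exists2 A, F A & A `&` K = set0.
Proof.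
move=> cK [A0 FA0] clF dF KF; apply: contrapT => nF.
have filK : ProperFilter (filter_from F (fun A => A `&` K)).
  apply: filter_from_proper; last first.
    move=> A FA; apply/set0P/eqP => AK0; apply: nF; by exists A.
  apply: filter_from_filter; first by exists A0.
  move=> A B FA FB; have [C FC CAB] := dF _ _ FA FB.
  by exists C => // x [/CAB[Ax Bx] Kx].
have [|x [Kx clx]] := cK _ filK; first by exists A0 => // x [].
have [A FA nAx] := KF _ Kx; apply: nAx; rewrite (closure_id A).1; last exact: clF.
move=> B nB; have [||y [[Ay _] By]] := clx (A `&` K) B => //; last by exists y.
by exists A.
Qed.

(** By regularity, each point of [A] is avoided by the closure of some open set containing [B]; such
    closures are directed downwards, so by compactness one of them misses all of [A]. *)
Lemma compact_separated A B : hausdorff_space T ->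
  (forall x : T, exists2 K : set T, nbhs x K & compact K) ->
  compact A -> closed B -> A `&` B = set0 ->
  exists O1 O2 : set T, [/\ open O1, open O2, A `<=` O1, B `<=` O2 &
    O1 `&` O2 = set0].
Proof.
move=> hT lcT cA clB AB0.
pose F := [set closure V | V in [set V | open V /\ B `<=` V]].
have [||||C [V [oV BV] <-] VA0] := @compact_bigcap_disjoint A F cA.
- by exists (closure setT), setT => //; split=> //; exact: openT.
- by move=> _ [V _ <-]; exact: closed_closure.
- move=> _ _ [V [oV BV] <-] [V' [oV' BV'] <-]; exists (closure (V `&` V')).
    exists (V `&` V') => //; split; first exact: openI.
    by move=> x Bx; split; [exact: BV|exact: BV'].
  exact: closureI.
- move=> x Ax; have [K nK cK] := lcT x.
  have [|D nD DB] := @compact_regular T x K hT cK nK (~` B).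
    apply: open_nbhs_nbhs; split; first exact: closed_openC.
    by move=> Bx; have : (A `&` B) x by []; rewrite AB0.
  exists (closure (~` closure D)).
    exists (~` closure D) => //; split.
      exact/closed_openC/closed_closure.
    by move=> y By /DB.
  move=> /(_ _ nD) [y [nDy Dy]]; apply: nDy; exact: subset_closure.
exists (~` closure V), V; split=> //.
- exact/closed_openC/closed_closure.
- by move=> x Ax clx; have : (closure V `&` A) x by []; rewrite VA0.
- by apply/seteqP; split=> // x [nV /subset_closure].
Qed.

(** In a compact neighbourhood of [x] the quasi-component [Q] of [x] is connected, hence reduced to
    [x]; by compactness some relatively clopen set around [x] then lies in [A]. *)
Lemma totally_disconnected_compact_open (x : T) A : hausdorff_space T ->
  totally_disconnected [set: T] ->
  (forall x : T, exists2 K : set T, nbhs x K & compact K) -> nbhs x A ->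
  exists D : set T, [/\ D x, D `<=` A, open D & compact D].
Proof.
move=> hT tdT lcT nA.
have [C nC cC] := lcT x; have clC := compact_closed hT cC.
(* These are the sets around [x] that are clopen relative to [C]. *)
pose F := [set D | [/\ D x, D `<=` C, closed D & closed (C `\` D)]].
have FC : F C.
  by split=> //; [exact: nbhs_singleton|rewrite setDv; exact: closed0].
have dF D D' : F D -> F D' -> F (D `&` D').
  move=> [Dx DC clD clCD] [D'x D'C clD' clCD']; split=> //.
  - by move=> y [/DC].
  - exact: closedI.
  - by rewrite setDIr; exact: closedU.
have sepF K : closed K -> K `<=` C -> (forall y, K y -> exists2 D, F D & ~ D y) ->
    exists2 D, F D & D `&` K = set0.
  move=> clK KC KF; apply: compact_bigcap_disjoint KF => //.
  - exact: subclosed_compact clK cC KC.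
  - by exists C.
  - by move=> D [].
  - by move=> D D' FD FD'; exists (D `&` D') => //; exact: dF.
pose Q := \bigcap_(D in F) D.
have Qx : Q x by move=> D [].
have clQ : closed Q by apply: closed_bigI => D [].
have QC : Q `<=` C by apply: bigcap_inf.
have cQ : compact Q by exact: subclosed_compact clQ cC QC.
have conQ : connected Q.
  (* a clopen piece of [Q] containing [x] is cut out by a member of [F] *)
  have pieceQ P P' : closed P -> closed P' -> P x -> Q `<=` P `|` P' ->
      P `&` P' `&` Q = set0 -> Q `<=` P.
    move=> clP clP' Px QPP' PP'0.
    have [|||O1 [O2 [oO1 oO2 PO1 P'O2 O120]]] :=
        @compact_separated (P `&` Q) (P' `&` Q) hT lcT.
    - by apply: subclosed_compact cQ _ => [|y []//]; exact: closedI.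
    - exact: closedI.
    - by rewrite setIACA setIid.
    have [||y /= [Cy nOy]|D FD DO] := sepF (C `\` (O1 `|` O2)).
    - by apply: closedI => //; apply: open_closedC; exact: openU.
    - by move=> y [].
    - apply: contrapT => nD; apply: nOy.
      have Qy : Q y.
        by move=> D FD; apply: contrapT => nDy; apply: nD; exists D.
      by have [Py|P'y] := QPP' _ Qy; [left; exact: PO1|right; exact: P'O2].
    have DO12 y : D y -> O1 y \/ O2 y.
      move=> Dy; apply: contrapT => nOy.
      suff : (D `&` (C `\` (O1 `|` O2))) y by rewrite DO.
      by split=> //; split=> //; case: FD => _ + _ _; apply.
    (* Since [D] is covered by the disjoint open sets [O1] and [O2], removing [O2] leaves a
       relatively clopen set around [x]; it contains [Q], which therefore misses [O2]. *)
    have FO1 : F (D `\` O2).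
      case: FD => Dx DC clD clCD; split.
      - split=> // O2x.
        by have : (O1 `&` O2) x; [split=> //; exact: PO1|rewrite O120].
      - by move=> y [/DC].
      - by apply: closedI => //; exact: open_closedC.
      - rewrite (_ : _ `\` _ = (C `\` D) `|` (D `\` O1)).
          by apply: closedU => //; apply: closedI => //; exact: open_closedC.
        apply/seteqP; split=> y /=.
          move=> [Cy nDO]; have [Dy|nDy] := pselect (D y); last by left.
          right; split=> // O1y; apply: nDO; split=> // O2y.
          by have : (O1 `&` O2) y by []; rewrite O120.
        move=> [[Cy nDy]|[Dy nO1y]]; first by split=> // -[].
        split; first exact: DC.
        by move=> [_ nO2y]; have [] := DO12 _ Dy.
    move=> y Qy; have [//|P'y] := QPP' _ Qy.
    by have [_ []] := Qy _ FO1; exact: P'O2.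
  (* [B] is the trace on [Q] of both the open [O] and the closed [P]. If [x] is in [B], then
     [pieceQ] puts [Q] inside [P], so [B] is [Q]; otherwise it puts [Q] outside [O], and [B] would
     be empty. *)
  move=> B [b Bb] [O oO BO] [P clP BP].
  have QB : Q `<=` P `|` ~` O.
    move=> y Qy; have [Oy|nOy] := pselect (O y); [left|by right].
    by have : B y; [rewrite BO|rewrite BP => -[]].
  have PO0 : P `&` ~` O `&` Q = set0.
    apply/seteqP; split=> // y [[Py nOy] Qy]; apply: nOy.
    by have : B y; [rewrite BP|rewrite BO => -[]].
  have clO : closed (~` O) by exact: open_closedC.
  have [Bx|nBx] := pselect (B x).
    rewrite BP; apply/setIidPl; apply: pieceQ QB PO0 => //.
    by move: Bx; rewrite BP => -[].
  exfalso; apply: nBx; rewrite BO; split=> //.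
  have [Ox //|nOx] := pselect (O x).
  have QnO : Q `<=` ~` O.
    by apply: (pieceQ _ P) => //; rewrite 1?setUC 1?(setIC (~` O)).
  by move: Bb; rewrite BO => -[/QnO].
have Q1 : Q `<=` [set x].
  by rewrite -(tdT x I); exact: connected_component_max.
have : nbhs x (A `&` C) by exact: filterI.
rewrite nbhsE => -[O [oO Ox] OAC].
have [||y /= [Cy nOy]|D FD DO0] := sepF (C `\` O).
- by apply: closedI => //; exact: open_closedC.
- by move=> y [].
- apply: contrapT => nD.
  have /Q1 yx : Q y.
    by move=> D FD; apply: contrapT => nDy; apply: nD; exists D.
  by apply: nOy; rewrite yx.
case: (FD) => Dx DC clD clCD.
(* [D] is clopen relative to [C]; lying in the open set [O], itself inside [C], makes it open in the
   whole space. *)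
have DO : D `<=` O.
  move=> y Dy; apply: contrapT => nOy.
  by have : (D `&` (C `\` O)) y; [split=> //; split=> //; exact: DC|rewrite DO0].
exists D; split=> //.
- by move=> y /DO/OAC[].
- rewrite (_ : D = O `&` ~` (C `\` D)); first by apply: openI => //; exact: closed_openC.
  apply/seteqP; split=> y; first by move=> Dy; split; [exact: DO|move=> []].
  move=> [Oy nCD]; apply: contrapT => nDy; apply: nCD; split=> //.
  by have [] := OAC _ Oy.
- exact: subclosed_compact clD cC DC.
Qed.

End CompactSpaces.

(** * Normalizers, product sets and cores in abstract groups *)

Section Groups.
Context {G : groupType}.
Implicit Types (A B H K L N : set G) (x y : G).

Lemma is_subgroupI H K : is_subgroup H -> is_subgroup K -> is_subgroup (H `&` K).
Proof.
move=> [H1 HB] [K1 KB]; split=> // x y [Hx Kx] [Hy Ky].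
by split; [exact: HB|exact: KB].
Qed.

Lemma is_subgroup_generated A : is_subgroup (generated A).
Proof.
split=> [K [[K1 _] _] //|x y Ax Ay K [sK AK]].
by case: (sK) => _; apply; [exact: Ax|exact: Ay].
Qed.

Lemma generated_sub A H : is_subgroup H -> A `<=` H -> generated A `<=` H.
Proof. exact: smallest_sub. Qed.

Lemma normalizesP H A : is_subgroup H ->
  (forall h x, H h -> A x -> A (x ^ h)) -> normalizes H A.
Proof.
move=> sH HA h Hh; apply/seteqP; split=> [_ [x Ax <-]|x Ax]; first exact: HA.
exists (x ^ h^-1); last by rewrite conjgKV.
by apply: HA => //; exact: is_subgroupV.
Qed.

Lemma normalizesJ H A h x : normalizes H A -> H h -> A x -> A (x ^ h).
Proof. by move=> nA Hh Ax; rewrite -(nA _ Hh); exists x. Qed.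

Lemma normalizes_sub H K A : K `<=` H -> normalizes H A -> normalizes K A.
Proof. by move=> KH nA h /KH; exact: nA. Qed.

Lemma normalizes_self H : is_subgroup H -> normalizes H H.
Proof.
move=> sH; apply: normalizesP => // h x Hh Hx.
by do 2?[apply: is_subgroupM => //]; exact: is_subgroupV.
Qed.

Lemma normalizesI H A B : is_subgroup H -> normalizes H A -> normalizes H B ->
  normalizes H (A `&` B).
Proof.
move=> sH nA nB; apply: normalizesP => // h x Hh [Ax Bx].
by split; exact: normalizesJ Hh _.
Qed.

Lemma normalizes_bigcap I (D : set I) (f : I -> set G) H : is_subgroup H ->
  (forall i, D i -> normalizes H (f i)) -> normalizes H (\bigcap_(i in D) f i).
Proof.
move=> sH nf; apply: normalizesP => // h x Hh fx i Di.
by apply: normalizesJ Hh _; [exact: nf|exact: fx].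
Qed.

Lemma is_subgroup_mul H N : is_subgroup H -> is_subgroup N -> normalizes H N ->
  is_subgroup (set_mul H N).
Proof.
move=> sH sN nN; split.
  by exists 1; [case: sH|exists 1; [case: sN|rewrite mulg1]].
move=> _ _ [h Hh [n Nn <-]] [k Hk [m Nm <-]].
exists (h / k); first by case: sH => _; apply.
exists ((n / m) ^ k^-1).
  apply: normalizesJ nN _ _; first exact: is_subgroupV.
  by case: sN => _; apply.
by rewrite /conjg invgK invgM !mulgA mulgVK.
Qed.

Lemma set_mulC H N : is_subgroup H -> normalizes H N -> set_mul N H = set_mul H N.
Proof.
move=> sH nN; apply/seteqP; split=> _ [x Hx [y Ny <-]].
  by exists y => //; exists (x ^ y); [exact: normalizesJ nN _ _|rewrite -conjgC].
exists (y ^ x^-1); first by apply: normalizesJ nN _ _ => //; exact: is_subgroupV.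
by exists x => //; rewrite -conjgCV.
Qed.

Lemma set_mulA A B N : set_mul A (set_mul B N) = set_mul (set_mul A B) N.
Proof.
apply/seteqP; split.
  move=> _ [a Aa [_ [b Bb [n Nn <-]] <-]]; exists (a * b); first by exists a => //; exists b.
  by exists n => //; rewrite mulgA.
move=> _ [_ [a Aa [b Bb <-]] [n Nn <-]]; exists a => //.
by exists (b * n); [exists b => //; exists n|rewrite mulgA].
Qed.

Lemma normalizes_mul H K A :
  normalizes H A -> normalizes K A -> normalizes (set_mul H K) A.
Proof.
move=> nH nK _ [h Hh [k Kk <-]]; rewrite -[RHS](nK _ Kk) -[in RHS](nH _ Hh).
apply/seteqP; split=> [_ [x Ax <-]|_ [_ [x Ax <-] <-]].
  by exists (x ^ h); [exists x|rewrite conjgM].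
by exists x; rewrite ?conjgM.
Qed.

Lemma set_mul_subl A N : N 1 -> A `<=` set_mul A N.
Proof. by move=> N1 x Ax; exists x => //; exists 1; rewrite ?mulg1. Qed.

Lemma set_mul_subr A N : A 1 -> N `<=` set_mul A N.
Proof. by move=> A1 x Nx; exists 1 => //; exists x; rewrite ?mul1g. Qed.

Lemma set_mul_subgroup A B L : is_subgroup L -> A `<=` L -> B `<=` L ->
  set_mul A B `<=` L.
Proof.
by move=> sL AL BL _ [a /AL La [b /BL Lb <-]]; exact: is_subgroupM.
Qed.

(** The intersection of the conjugates of [A] by the elements of [X]; for a subgroup [A] and [X] the
    whole group it is the normal core. *)
Definition conj_core A X : set G := [set y | forall x, X x -> A (y ^ x^-1)].

Lemma is_subgroup_conj_core H A : is_subgroup H -> is_subgroup (conj_core H A).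
Proof.
move=> sH; split=> [x Ax|x y Hx Hy z Az]; first by rewrite conj1g; case: sH.
by rewrite conjMg conjVg; case: sH => _; apply; [exact: Hx|exact: Hy].
Qed.

Lemma conj_core_sub A B : B 1 -> conj_core A B `<=` A.
Proof. by move=> B1 x /(_ 1 B1); rewrite invg1 conjg1. Qed.

(** As [A] is invariant, conjugation by [h] carries its conjugate by [x] to its conjugate by
    [x ^ h]; as [B] is invariant too, the conjugates being intersected are permuted. *)
Lemma normalizes_conj_core H A B : is_subgroup H ->
  normalizes H A -> normalizes H B -> normalizes H (conj_core A B).
Proof.
move=> sH nA nB; apply: normalizesP => // h y Hh cy x Bx.
have -> : (y ^ h) ^ x^-1 = (y ^ (x ^ h^-1)^-1) ^ h.
  rewrite -!conjgM; congr (y ^ _).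
  by rewrite /conjg !invgM !invgK mulgVK.
apply: (normalizesJ nA Hh); apply: cy; apply: (normalizesJ nB) => //.
exact: is_subgroupV.
Qed.

Lemma normalizes_conj_core_self H A : is_subgroup H -> normalizes H (conj_core A H).
Proof.
move=> sH; apply: normalizesP => // h y Hh cy x Hx.
rewrite -conjgM -[h / x]invgK invgM invgK; apply: cy.
by case: sH => _; apply.
Qed.

End Groups.

(** * Open subgroups, van Dantzig's theorem and uniformity over compact sets *)

Section TopologicalGroupTheory.
Context {G : topologicalGroupType}.
Implicit Types (A B H K L N O U V W X : set G) (x y : G).

Lemma cvg_mulg (T : Type) (F : set_system T) {FF : Filter F} (f g : T -> G) x y :
  f @ F --> x -> g @ F --> y -> (fun t => f t * g t) @ F --> x * y.
Proof.
by move=> fx gy; exact: (cvg_comp _ _ (cvg_pair fx gy) (mulg_continuous (x, y))).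
Qed.

Lemma cvg_invg (T : Type) (F : set_system T) {FF : Filter F} (f : T -> G) x :
  f @ F --> x -> (fun t => (f t)^-1) @ F --> x^-1.
Proof. by move=> fx; exact: (cvg_comp _ _ fx (invg_continuous x)). Qed.

Lemma cvg_conjg (T : Type) (F : set_system T) {FF : Filter F} (f g : T -> G) x y :
  f @ F --> x -> g @ F --> y -> (fun t => f t ^ g t) @ F --> x ^ y.
Proof.
move=> fx gy; apply: cvg_mulg; first exact: cvg_invg.
exact: cvg_mulg.
Qed.

Lemma mulgl_continuous x : continuous (fun y => x * y).
Proof. by move=> y; apply: cvg_mulg; [exact: cvg_cst|exact: cvg_id]. Qed.

Lemma mulgr_continuous x : continuous (fun y => y * x).
Proof. by move=> y; apply: cvg_mulg; [exact: cvg_id|exact: cvg_cst]. Qed.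

Lemma conjg_continuous x : continuous (fun y => y ^ x).
Proof. by move=> y; apply: cvg_conjg; [exact: cvg_id|exact: cvg_cst]. Qed.

Lemma open_lcoset x A : open A -> open (lcoset x A).
Proof.
move=> oA; rewrite (_ : lcoset x A = (fun y => x^-1 * y) @^-1` A).
  by apply: open_comp => // y _; exact: mulgl_continuous.
apply/seteqP; split=> y /=; first by move=> [z Az <-]; rewrite mulKg.
by move=> Axy; exists (x^-1 * y) => //; rewrite mulVKg.
Qed.

Lemma nbhs_lcoset x A : nbhs 1 A -> nbhs x (lcoset x A).
Proof.
rewrite nbhsE => -[O [oO O1] OA].
apply: (@filterS _ _ _ (lcoset x O)) => [_ [y /OA Ay <-]|]; first by exists y.
by apply: open_nbhs_nbhs; split; [exact: open_lcoset|exists 1; rewrite ?mulg1].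
Qed.

Lemma open_set_mul A B : open B -> open (set_mul A B).
Proof.
move=> oB; rewrite (_ : set_mul A B = \bigcup_(a in A) lcoset a B).
  by apply: bigcup_open => a _; exact: open_lcoset.
by apply/seteqP; split=> _ [a Aa [b Bb <-]]; exists a => //; exists b.
Qed.

Lemma open_set_mulr A B : open A -> open (set_mul A B).
Proof.
move=> oA; rewrite (_ : set_mul A B = \bigcup_(b in B) ((fun y => y * b^-1) @^-1` A)).
  apply: bigcup_open => b _; apply: open_comp => // y _.
  exact: mulgr_continuous.
apply/seteqP; split=> [_ [a Aa [b Bb <-]]|y [b Bb Ayb]].
  by exists b => //=; rewrite mulgK.
by exists (y * b^-1) => //; exists b => //; rewrite mulgVK.
Qed.

Lemma open_subgroupP L : is_subgroup L -> nbhs 1 L -> open_subgroup L.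
Proof.
move=> sL nL; split=> //; rewrite openE => x Lx.
apply: filterS (nbhs_lcoset x nL) => _ [y Ly <-]; exact: is_subgroupM.
Qed.

Lemma nbhs_open_subgroup L : open_subgroup L -> nbhs 1 L.
Proof. by move=> [[L1 _] oL]; exact: open_nbhs_nbhs. Qed.

Lemma closed_open_subgroup L : open_subgroup L -> closed L.
Proof.
move=> oL; rewrite -[L]setCK; apply: open_closedC; rewrite openE => x nLx.
have [sL _] := oL; apply: filterS (nbhs_lcoset x (nbhs_open_subgroup oL)).
move=> _ [y Ly <-] Lxy; apply: nLx; rewrite -(mulgK y x).
by apply: is_subgroupM => //; exact: is_subgroupV.
Qed.

Lemma open_subgroupI L K : open_subgroup L -> open_subgroup K ->
  open_subgroup (L `&` K).
Proof. by move=> [? ?] [? ?]; split; [exact: is_subgroupI|exact: openI]. Qed.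

Lemma compact_open_subgroupI U L : compact U -> open_subgroup L -> compact (U `&` L).
Proof. by move=> cU /closed_open_subgroup; exact: compact_closedI. Qed.

(** Multiplication is continuous at each [(k, 1)] and sends it into the open set [K]; compactness
    makes the neighbourhood of [1] uniform in [k]. *)
Lemma compact_open_nbhs_mulg K : compact K -> open K ->
  \forall v \near (1 : G), forall k, K k -> K (k * v).
Proof.
move=> /compact_near_coveringP cK oK.
apply: (cK G (nbhs 1) (fun v k => K (k * v))) => k Kk.
have : (fun z : G * G => z.1 * z.2) @ filter_prod (nbhs k) (nbhs 1) --> k * 1.
  by apply: cvg_mulg; [exact: cvg_fst|exact: cvg_snd].
by rewrite mulg1; apply; exact: open_nbhs_nbhs.
Qed.

(** Van Dantzig's theorem. For a compact open [K] inside [A], the elements [v] with [K v ⊆ K] form a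
    monoid; those whose inverse also belongs to it form an open subgroup, contained in [K] because
    [1] is in [K]. *)
Lemma totally_disconnected_compact_open_subgroup A : hausdorff_space G ->
  totally_disconnected [set: G] -> locally_compact [set: G] -> nbhs 1 A ->
  exists U : set G, [/\ open_subgroup U, compact U & U `<=` A].
Proof.
move=> hG tdG lcG nA.
have lcG' (x : G) : exists2 K : set G, nbhs x K & compact K.
  have [K] := lcG x I; rewrite withinET => nK [cK _].
  by exists K.
have [K [K1 KA oK cK]] := totally_disconnected_compact_open hG tdG lcG' nA.
pose V := [set v : G | forall k, K k -> K (k * v)].
have nV : nbhs 1 V by exact: compact_open_nbhs_mulg.
pose U := V `&` [set v | V v^-1].
have oU : open_subgroup U.
  apply: open_subgroupP.
    have V1 : V 1 by move=> k; rewrite mulg1.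
    have VM x y : V x -> V y -> V (x * y).
      by move=> Vx Vy k Kk; rewrite mulgA; apply/Vy/Vx.
    split=> [|x y [Vx Vx'] [Vy Vy']]; first by split=> //=; rewrite invg1.
    by split; [exact: VM|rewrite /= invgF; exact: VM].
  apply: filterI => //; apply: (@invg_continuous G 1); rewrite invg1; exact: nV.
have UK : U `<=` K by move=> v [/(_ _ K1)]; rewrite mul1g.
exists U; split=> //; last by move=> x /UK/KA.
exact: subclosed_compact (closed_open_subgroup oU) cK UK.
Qed.

Lemma compact_finite_lcosets K L : compact K -> open_subgroup L ->
  finite_set [set lcoset x L | x in K].
Proof.
move=> /compact_near_coveringP cK oL; have [sL _] := oL.
(* What holds eventually along [F] holds for some finite set of cosets, so the near covering
   property yields a finite set containing the coset of every point of [K]. *)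
pose F := filter_from (@finite_set (set G)) (fun C => [set D | C `<=` D]).
have FF : Filter F.
  apply: filter_from_filter; first by exists set0; exact: finite_set0.
  move=> C C' fC fC'; exists (C `|` C'); first by rewrite finite_setU.
  by move=> D; rewrite /= subUset => -[].
have [|C fC CK] := cK _ F (fun C x => C (lcoset x L)) FF.
  move=> x Kx; exists (lcoset x L, [set C | C (lcoset x L)]).
    split; first exact: nbhs_lcoset (nbhs_open_subgroup oL).
    by exists [set lcoset x L] => //= C; apply.
  by move=> [y C] /= [xy]; rewrite -(lcoset_eq sL xy).
by apply: sub_finite_set fC => _ [x Kx <-]; exact: CK.
Qed.

(** The map sending [(k, y)] to [y ^ k^-1] takes [(k, 1)] to [1]; compactness gives one
    neighbourhood of [1] for all [k]. *)
Lemma open_subgroup_conj_core K P : compact K -> is_subgroup P -> open P ->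
  nbhs 1 (conj_core P K).
Proof.
move=> /compact_near_coveringP cK [P1 _] oP.
apply: (cK G (nbhs 1) (fun y k => P (y ^ k^-1))) => k Kk.
have : (fun z : G * G => z.2 ^ z.1^-1) @ filter_prod (nbhs k) (nbhs 1) --> 1 ^ k^-1.
  by apply: cvg_conjg; [exact: cvg_snd|apply: cvg_invg; exact: cvg_fst].
by rewrite conj1g; apply; exact: open_nbhs_nbhs.
Qed.

(** For [h] in [H], whether [y ^ h] lies in [L] depends only on the coset of [h] modulo [H ∩ L], so
    the core is an intersection of finitely many conjugates of [L]. *)
Lemma open_subgroup_finite_index_conj_core H L : is_subgroup H ->
  open_subgroup L -> finite_index H (H `&` L) -> open_subgroup (conj_core L H).
Proof.
move=> sH oL /finite_fsetP[F HF]; have [sL _] := oL.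
apply: open_subgroupP; first exact: is_subgroup_conj_core.
have nL h : nbhs 1 [set y | L (y ^ h)].
  by apply: (@conjg_continuous h 1); rewrite conj1g; exact: nbhs_open_subgroup.
have : nbhs 1 (\bigcap_(C in [set` F]) [set y : G | forall h, C h -> L (y ^ h)]).
  apply: filter_bigI => C FC.
  have : [set` F] C by [].
  rewrite -HF => -[h Hh <-]; apply: filterS (nL h) => y Ly _ [k [Hk Lk] <-].
  by rewrite conjgM; exact: normalizesJ (normalizes_self sL) Lk Ly.
apply: filterS => y Fy x Hx; apply: (Fy (lcoset x^-1 (H `&` L))).
  by rewrite -HF; exists x^-1 => //; exact: is_subgroupV.
by apply: lcoset_refl; exact: is_subgroupI.
Qed.

Lemma SubRes H P : open_subgroup P -> normalizes H P -> Res H `<=` P.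
Proof. by move=> oP nP x; apply. Qed.

Lemma is_subgroup_Res H : is_subgroup (Res H).
Proof.
split=> [P [[[P1 _] _] _] //|x y Rx Ry P PH].
by case: (PH) => -[[_ PD] _] _; apply: PD; [exact: Rx|exact: Ry].
Qed.

Lemma normalizes_Res H : is_subgroup H -> normalizes H (Res H).
Proof. by move=> sH; apply: normalizes_bigcap => // P [_]. Qed.

End TopologicalGroupTheory.

(** * Groups of automorphisms and equicontinuity *)

Section Automorphisms.
Context {G : topologicalGroupType}.
Implicit Types (S A : set (G -> G)) (f g : G -> G) (H K E X : set G).

Lemma can_inverse_unique f g g' : cancel g f -> cancel f g' -> g' = g.
Proof. by move=> gK fK; apply/funext => x; rewrite -{1}(gK x) fK. Qed.

Lemma automorphism_group_automorphisms :
  automorphism_group [set f : G -> G | is_automorphism f].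
Proof.
split=> //.
- split=> //; first by move=> x; exact: cvg_id.
  by exists id; split=> // x; exact: cvg_id.
- move=> f g [fM cf [f' [fK f'K cf']]] [gM cg [g' [gK g'K cg']]]; split.
  + by move=> x y /=; rewrite gM fM.
  + by move=> x; apply: continuous_comp; [exact: cg|exact: cf].
  + exists (g' \o f'); split; [exact: can_comp|exact: can_comp|].
    by move=> x; apply: continuous_comp; [exact: cf'|exact: cg'].
- move=> f g [fM cf [g' [fK g'K cg']]] fg gf.
  rewrite (can_inverse_unique g'K fg); split=> //; last by exists f.
  by move=> x y; apply: (can_inj fK); rewrite fM !g'K.
Qed.

Lemma is_automorphism_conjg x : is_automorphism (fun y : G => y ^ x).
Proof.
split; [by move=> y z; rewrite conjMg|exact: conjg_continuous|].
exists (fun y => y ^ x^-1); split; [exact: conjgK|exact: conjgKV|].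
exact: conjg_continuous.
Qed.

Lemma automorphism_group_conjugation_action H : is_subgroup H ->
  automorphism_group (conjugation_action H).
Proof.
move=> sH; split.
- by move=> _ [h _ <-]; exact: is_automorphism_conjg.
- by exists 1; [case: sH|apply/funext => x; rewrite conjg1].
- move=> _ _ [h Hh <-] [k Hk <-]; exists (k * h); first exact: is_subgroupM.
  by apply/funext => x; rewrite /= conjgM.
- move=> _ g [h Hh <-] fK gK; exists h^-1; first exact: is_subgroupV.
  by apply: can_inverse_unique gK _ => x; rewrite conjgK.
Qed.

Lemma automorphism_group_generated S : S `<=` [set f | is_automorphism f] ->
  automorphism_group (generated_automorphism_group S).
Proof.
move=> SA; split.
- exact: smallest_sub automorphism_group_automorphisms SA.
- by move=> A [[]].
- by move=> f g Sf Sg A AS; case: (AS) => -[_ _ + _] _; apply; [exact: Sf|exact: Sg].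
- by move=> f g Sf fg gf A AS; case: (AS) => -[_ _ _ +] _; apply; [exact: Sf|..].
Qed.

Lemma sub_generated_automorphism_group S : S `<=` generated_automorphism_group S.
Proof. exact: sub_gen_smallest. Qed.

Lemma generated_automorphism_group_sub S A : automorphism_group A -> S `<=` A ->
  generated_automorphism_group S `<=` A.
Proof. exact: smallest_sub. Qed.

(** The automorphisms mapping [X] onto itself form a group, while those mapping [X] into itself need
    not; symmetry of [S] turns the inclusion into an equality on generators. *)
Lemma generated_automorphism_group_invariant S X :
  S `<=` [set f | is_automorphism f] -> symmetric_automorphism_set S ->
  (forall s x, S s -> X x -> X (s x)) ->
  forall f x, generated_automorphism_group S f -> X x -> X (f x).
Proof.
move=> SA symS SX f x Sf Xx.
pose A := [set f | is_automorphism f /\ f @` X = X].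
have [A1 A2 A3 A4] := automorphism_group_automorphisms.
suff : generated_automorphism_group S `<=` A by move=> /(_ f Sf)[_ <-]; exists x.
apply: generated_automorphism_group_sub.
  split; first by move=> g [].
  - by split=> //; rewrite image_id.
  - by move=> g h [Ag gX] [Ah hX]; split; [exact: A3|rewrite -image_comp hX].
  - move=> g h [Ag gX] gh hg; split; first exact: A4 gh hg.
    rewrite -[in LHS]gX image_comp (_ : h \o g = id) ?image_id//.
    by apply/funext.
move=> s Ss; split; first exact: SA.
have [t [St sK tK]] := symS _ Ss.
apply/seteqP; split=> [_ [y Xy <-]|y Xy]; first exact: SX.
by exists (t y); rewrite ?tK//; exact: SX.
Qed.

(** Equicontinuity at [1] gives [1 = s 1 = u * s v] with [u] in [U], so [s v] is [u^-1]. *)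
Lemma equicontinuous_nbhs1 S U : S `<=` [set f | is_automorphism f] ->
  equicontinuous_automorphism_set S -> open_subgroup U ->
  \forall v \near (1 : G), forall s, S s -> U (s v).
Proof.
move=> SA eS oU; have [sU _] := oU.
have [W nW WU] := eS 1 U (nbhs_open_subgroup oU).
apply: filterS nW => v Wv s Ss; have [u Uu] := WU s v Ss Wv.
have [sM _ _] := SA _ Ss.
have -> : s 1 = 1 by apply: (@mulgI _ (s 1)); rewrite -sM !mulg1.
by move=> /esym/mulg1_eq <-; exact: is_subgroupV.
Qed.

(** The quotient [x ^ k / y ^ k] is continuous in [(k, y)] and equals [1] at [y = x]; compactness of
    [K] makes this uniform in [k]. *)
Lemma equicontinuous_conjugation_action K : compact K ->
  equicontinuous_automorphism_set (conjugation_action K).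
Proof.
move=> /compact_near_coveringP cK x U nU.
have nW : \forall y \near x, forall k, K k -> U (x ^ k / y ^ k).
  apply: (cK G (nbhs x) (fun y k => U (x ^ k / y ^ k))) => k Kk.
  have : (fun z : G * G => x ^ z.1 / z.2 ^ z.1) @ filter_prod (nbhs k) (nbhs x)
      --> x ^ k / x ^ k.
    apply: cvg_mulg; first by apply: cvg_conjg; [exact: cvg_cst|exact: cvg_fst].
    by apply: cvg_invg; apply: cvg_conjg; [exact: cvg_snd|exact: cvg_fst].
  by rewrite mulgV; apply.
exists [set y | forall k, K k -> U (x ^ k / y ^ k)] => // _ y [k Kk <-] Wy.
by exists (x ^ k / y ^ k); [exact: Wy|rewrite mulgVK].
Qed.

Lemma equicontinuousU S A : equicontinuous_automorphism_set S ->
  equicontinuous_automorphism_set A -> equicontinuous_automorphism_set (S `|` A).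
Proof.
move=> eS eA x U nU; have [V nV VU] := eS x U nU; have [W nW WU] := eA x U nU.
exists (V `&` W); first exact: filterI.
by move=> s y [Ss|As] [Vy Wy]; [exact: VU|exact: WU].
Qed.

(** The conjugations by the compact subgroup [K] form a symmetric equicontinuous set, which is added
    to the generating set [S] for [H]. *)
Lemma equicontinuously_generatedU H K : is_subgroup H ->
  equicontinuously_generated H -> is_subgroup K -> compact K ->
  equicontinuously_generated (generated (H `|` K)).
Proof.
move=> sH [S [SA symS eS HS]] sK cK; set E := generated _.
have sE : is_subgroup E by exact: is_subgroup_generated.
have [HE KE] : H `<=` E /\ K `<=` E by split=> x Ax; apply: sub_gen_smallest; [left|right].
have SKA : S `|` conjugation_action K `<=` [set f | is_automorphism f].
  by move=> f [/SA //|[k _ <-]]; exact: is_automorphism_conjg.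
exists (S `|` conjugation_action K); split=> //.
- move=> s [Ss|[k Kk <-]].
    by have [t [St sKt tK]] := symS _ Ss; exists t; split=> //; left.
  exists (fun y => y ^ k^-1); split; [right|exact: conjgK|exact: conjgKV].
  by exists k^-1 => //; exact: is_subgroupV.
- by apply: equicontinuousU => //; exact: equicontinuous_conjugation_action.
have [_ M1 M2 M3] := automorphism_group_generated SKA.
apply/seteqP; split; last first.
  apply: generated_automorphism_group_sub.
    exact: automorphism_group_conjugation_action.
  move=> f [Sf|[k /KE Ek <-]]; last by exists k.
  have : conjugation_action H f by rewrite HS; exact: sub_generated_automorphism_group.
  by move=> [h /HE Eh <-]; exists h.
(* The elements whose conjugation lies in the generated group form a subgroup containing [H] and
   [K], hence [E]. *)
pose M := [set x : G | generated_automorphism_group (S `|` conjugation_action K)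
                 (fun y => y ^ x)].
suff EM : E `<=` M by move=> _ [x /EM Mx <-].
apply: generated_sub.
  split=> [|x y Mx My]; first by rewrite /M/= (_ : (fun y => _) = id)//;
    apply/funext => y; rewrite conjg1.
  rewrite /M/= (_ : (fun z => _) = (fun z => z ^ y^-1) \o (fun z => z ^ x)); last first.
    by apply/funext => z; rewrite /= conjgM.
  by apply: M2 => //; apply: M3 My _ _; [exact: conjgK|exact: conjgKV].
move=> x [Hx|Kx]; last by apply: sub_generated_automorphism_group; right; exists x.
have : conjugation_action H (fun y => y ^ x) by exists x.
rewrite HS; apply: generated_automorphism_group_sub.
  exact: automorphism_group_generated.
by move=> s Ss; apply: sub_generated_automorphism_group; left.
Qed.

End Automorphisms.

(** * The invariant subgroup [Res H * W], its open normal subgroups, and finite index *)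

Section ReducedEnvelope.
Context {G : topologicalGroupType}.
Implicit Types (E H K L N O P U V W X : set G) (x y : G).

(** The open [H]-invariant subgroups are closed and directed downwards, and no point of the compact
    set [U \ O] lies in all of them. *)
Lemma compact_Res_open H U O : is_subgroup H -> compact U -> closed U -> open O ->
  U `&` Res H `<=` O ->
  exists P, [/\ open_subgroup P, normalizes H P & U `&` P `<=` O].
Proof.
move=> sH cU clU oO URO.
have [|||||P [oP nP] PUO] := @compact_bigcap_disjoint G (U `\` O)
    [set P | open_subgroup P /\ normalizes H P].
- apply: subclosed_compact cU _ => [|x []//].
  by apply: closedI => //; exact: open_closedC.
- exists setT; split; first by split; [split|exact: openT].
  exact: normalizesP.
- by move=> P [/closed_open_subgroup].
- move=> P P' [oP nP] [oP' nP']; exists (P `&` P') => //; split.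
    exact: open_subgroupI.
  exact: normalizesI.
- move=> x [Ux nOx]; apply: contrapT => nP; apply: nOx; apply: URO; split=> //.
  by move=> P PH; apply: contrapT => nPx; apply: nP; exists P.
exists P; split=> // x [Ux Px]; apply: contrapT => nOx.
by have : (P `&` (U `\` O)) x by []; rewrite PUO.
Qed.

(** The envelope is built from an arbitrary [U]; a small [U] serves for the SIN property. *)
Lemma Res_mul_normalized H U : hausdorff_space G ->
  totally_disconnected [set: G] -> locally_compact [set: G] ->
  is_subgroup H -> equicontinuously_generated H ->
  open_subgroup U -> compact U ->
  exists W, [/\ open_subgroup W, compact W, W `<=` U &
    normalizes H (set_mul (Res H) W)].
Proof.
move=> hG tdG lcG sH [S [SA symS eS HS]] oU cU.
have SH s : S s -> conjugation_action H s.
  by move=> Ss; rewrite HS; exact: sub_generated_automorphism_group.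
have [V [[sV oV] cV VU]] := totally_disconnected_compact_open_subgroup hG tdG lcG
  (equicontinuous_nbhs1 SA eS oU).
have [|P [oP nP UPO]] := @compact_Res_open H U (set_mul (Res H) V) sH cU
    (closed_open_subgroup oU) (open_set_mul _ oV).
  by move=> x [_ Rx]; apply: set_mul_subl => //; case: sV.
exists (U `&` P); split; [exact: open_subgroupI|exact: compact_open_subgroupI|by move=> x []|].
apply: normalizesP => // h x Hh.
have Sh : generated_automorphism_group S (fun y => y ^ h) by rewrite -HS; exists h.
apply: (generated_automorphism_group_invariant SA symS _ Sh).
move=> s _ Ss [r Rr [w [Uw Pw] <-]].
(* From [w = r' * v] one gets [s (r * w) = s (r * r') * s v]. Here [s v] is in [U] by the choice of
   [V], and in [P] because [v = r'^-1 * w] is and [P] is [H]-invariant. *)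
have [r' Rr' [v Vv rvw]] := UPO w (conj Uw Pw).
have [k Hk sE] := SH _ Ss.
have Rs z : Res H z -> Res H (s z).
  by rewrite -sE; exact: normalizesJ (normalizes_Res sH) Hk.
have [sM _ _] := SA _ Ss.
exists (s (r * r')); first by apply: Rs; exact: is_subgroupM (is_subgroup_Res H) _ _.
exists (s v); last by rewrite -sM -mulgA rvw.
split; first exact: VU.
rewrite -sE; apply: (normalizesJ nP) => //; rewrite -(mulKg r' v) rvw.
have [sP _] := oP; apply: is_subgroupM => //.
by apply: is_subgroupV => //; exact: (SubRes oP nP).
Qed.

(** Since [Res H] lies in [P], its elements normalize [P], so the conjugates of [P] by [Res H * W]
    are already conjugates by the compact set [W]. *)
Lemma open_subgroup_conj_core_Res H P W : open_subgroup P -> normalizes H P ->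
  compact W -> open_subgroup (conj_core P (set_mul (Res H) W)).
Proof.
move=> oP nP cW; have [sP oP'] := oP.
apply: open_subgroupP; first exact: is_subgroup_conj_core.
apply: filterS (open_subgroup_conj_core cW sP oP') => y Py _ [r Rr [w Ww <-]].
rewrite invgM conjgM; apply: (normalizesJ (normalizes_self sP)); last exact: Py.
by apply: is_subgroupV => //; exact: (SubRes oP nP).
Qed.

(** [Res H] lies in the core of every [P] over [Res H * W]; the condition defining this core, taken
    at [w^-1], says that [r ^ w] is in [P]. *)
Lemma normalizes_Res_compact H W : is_subgroup H -> is_subgroup W -> compact W ->
  normalizes H (set_mul (Res H) W) -> normalizes W (Res H).
Proof.
move=> sH sW cW nX; apply: normalizesP => // w r Ww Rr P [oP nP].
have := SubRes (open_subgroup_conj_core_Res oP nP cW)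
  (normalizes_conj_core sH nP nX) Rr.
move=> /(_ w^-1); rewrite invgK; apply; apply: set_mul_subr.
  by have [] := is_subgroup_Res H.
exact: is_subgroupV.
Qed.

(** The core of [P] over [X], cut down to [X], is normalized by [H], since [P] and [X] are, and by
    [X], hence by their product. *)
Lemma open_normal_subgroup_sub H P W : is_subgroup H -> open_subgroup W ->
  compact W -> normalizes H (set_mul (Res H) W) ->
  open_subgroup P -> normalizes H P ->
  exists N, [/\ is_normal_subgroup (set_mul H (set_mul (Res H) W)) N,
    open N & N `<=` P].
Proof.
move=> sH [sW oW] cW nX oP nP; set X := set_mul _ W.
have sX : is_subgroup X.
  rewrite /X set_mulC//; last exact: normalizes_Res_compact.
  apply: is_subgroup_mul => //; first exact: is_subgroup_Res.
  exact: normalizes_Res_compact.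
have [sQ oQ] := open_subgroup_conj_core_Res oP nP cW.
exists (conj_core P X `&` X); split; last first.
- by move=> x [Qx _]; apply: conj_core_sub Qx; case: sX.
- by apply: openI => //; exact: open_set_mul.
split.
- exact: is_subgroup_mul.
- exact: is_subgroupI.
- by move=> x [_ Xx]; apply: set_mul_subr => //; case: sH.
- apply: normalizes_mul; apply: normalizesI => //.
  + exact: normalizes_conj_core.
  + exact: normalizes_conj_core_self.
  + exact: normalizes_self.
Qed.

(** The core of [L] over [H] is open by finiteness of the index, so [L] contains [Res H] and the
    cosets of [E ∩ L] are represented by products [w * h]. Finitely many [h] suffice, and for each
    the compact set [W h] meets finitely many cosets of [L]. *)
Lemma finite_index_envelope H W L E : is_subgroup H -> compact W ->
  open_subgroup L -> finite_index H (H `&` L) -> is_subgroup E ->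
  H `<=` E -> W `<=` E ->
  E `<=` set_mul (set_mul W H) (Res H) -> Res H `<=` E -> finite_index E (E `&` L).
Proof.
move=> sH cW oL fH sE HE WE EWHR RE; have [sL _] := oL.
have RL : Res H `<=` L.
  move=> x Rx; have := SubRes (open_subgroup_finite_index_conj_core sH oL fH)
    (normalizes_conj_core_self _ sH) Rx.
  by apply: conj_core_sub; case: sH.
have sEL : is_subgroup (E `&` L) by exact: is_subgroupI.
have sHL : is_subgroup (H `&` L) by exact: is_subgroupI.
(* The cosets of [E ∩ L] are sorted by the coset [C] of the [H]-component of a representative. *)
pose f (C : set G) := [set D | exists w c, [/\ W w, C c & D = lcoset (w * c) (E `&` L)]].
suff : finite_set (\bigcup_(C in lcosets H (H `&` L)) f C).
  apply: sub_finite_set => _ [x Ex <-].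
  have [_ [w Ww [h Hh <-]] [r Rr wr]] := EWHR x Ex.
  exists (lcoset h (H `&` L)); first by exists h.
  exists w, h; split=> //; first exact: lcoset_refl.
  by apply/esym/lcoset_eq => //; exists r => //; split; [exact: RE|exact: RL].
apply: bigcup_finite => // _ [h Hh <-].
(* for [x] in [E], the coset of [E `&` L] through [x] is the trace on [E] of [lcoset x L] *)
have cWh : compact [set w * h | w in W].
  apply: continuous_compact => //; apply: continuous_subspaceT => w.
  exact: mulgr_continuous.
apply: (@sub_finite_set _ _ [set E `&` C | C in [set lcoset x L | x in [set w * h | w in W]]]).
  move=> D [w [_ [Ww [k [Hk Lk] <-] ->]]].
  exists (lcoset (w * h) L); first by exists (w * h) => //; exists w.
  have Ewh : E (w * h) by apply: is_subgroupM => //; [exact: WE|exact: HE].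
  rewrite -(@lcoset_eq _ (E `&` L) (w * h)) //; last first.
    by exists k; rewrite ?mulgA//; split=> //; exact: HE.
  apply/seteqP; split=> [y [Ey [l Ll yl]]|_ [l [El Ll] <-]].
    exists l => //; split=> //; rewrite -(mulKg (w * h) l) yl.
    by apply: is_subgroupM => //; exact: is_subgroupV.
  by split; [exact: is_subgroupM|exists l].
exact/finite_image/compact_finite_lcosets.
Qed.

End ReducedEnvelope.

(** * A criterion for a quotient to be a SIN group *)

Section Quotient.
Context {G : topologicalGroupType} {E R : set G} (nER : is_normal_subgroup E R).
Local Notation Q := (quotient_group nER).

Lemma quotient_group_eq (C D : Q) x : val C x -> val D x -> C = D.
Proof.
move=> Cx Dx; apply/val_inj.
by rewrite (lcosetsE nER (quotient_groupP C) Cx) (lcosetsE nER (quotient_groupP D) Dx).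
Qed.

(** The union of the cosets that meet [O] is [O R ∩ E]. *)
Lemma quotient_group_open_meet (O : set G) : open O -> open E ->
  open [set C : Q | exists2 y, val C y & O y].
Proof.
move=> oO oE; have [sE sR RE _] := nER; apply/open_subspaceP.
exists (set_mul O R `&` E); first by apply: openI => //; exact: open_set_mulr.
rewrite -setIA setIid; apply/seteqP; split=> x.
  move=> [[y Oy [r Rr yx]] Ex]; split=> //.
  have cx : lcoset x R \in lcosets E R by apply/mem_set; exists x.
  exists (Sub (lcoset x R) cx : Q); last exact: lcoset_refl.
  exists y => //; exists r^-1; first exact: is_subgroupV.
  by rewrite -yx mulgK.
move=> [[C [y Cy Oy] Cx] Ex]; split=> //; exists y => //.
by move: Cx; rewrite (lcosetsE nER (quotient_groupP C) Cy).
Qed.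

(** Separating points outside [R] by open normal subgroups gives the Hausdorff property; small open
    normal subgroups have invariant neighbourhoods as images. *)
Lemma quotient_group_SIN : open E ->
  (forall x, ~ R x -> exists N, [/\ is_normal_subgroup E N, open N, R `<=` N & ~ N x]) ->
  (forall O, open O -> O 1 -> exists N, [/\ is_normal_subgroup E N, open N &
     N `<=` set_mul O R]) ->
  SIN_group Q.
Proof.
move=> oE sepR smallN; have [sE sR RE nR] := nER; split.
  move=> C D cCD; apply: contrapT => nCD.
  have [x Ex Cx] := lcosets_neq0 nER (quotient_groupP C).
  have [y Ey Dy] := lcosets_neq0 nER (quotient_groupP D).
  have [|N [[_ sN NE _] oN RN nN]] := sepR (x^-1 * y).
    move=> Rxy; apply: nCD; apply: (quotient_group_eq _ Dy).
    by rewrite (lcosetsE nER (quotient_groupP C) Cx); exists (x^-1 * y); rewrite ?mulVKg.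
  have nbN (z : G) (B : Q) : val B z ->
      nbhs B [set B' : Q | exists2 t, val B' t & lcoset z N t].
    move=> Bz; apply: open_nbhs_nbhs; split.
      by apply: quotient_group_open_meet => //; exact: open_lcoset.
    by exists z => //; exact: lcoset_refl.
  (* A coset of [R] meeting both [x N] and [y N] forces [x^-1 * y] into [N], because [R] lies in
     [N]. *)
  have [B [[u Bu [n Nn xn]] [v Bv [m Nm ym]]]] := cCD _ _ (nbN _ _ Cx) (nbN _ _ Dy).
  apply: nN.
  move: Bv; rewrite (lcosetsE nER (quotient_groupP B) Bu) => -[r /RN Nr ur].
  have -> : x^-1 * y = n * r / m by rewrite -(mulgK m y) ym -ur -xn !mulgA mulVg mul1g.
  by case: (sN) => _; apply=> //; exact: is_subgroupM.
move=> U; rewrite {1}nbhsE => -[W [/open_subspaceP[O oO OW] W1] WU].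
have WR x : R x -> (\bigcup_(C in W) val C) x by move=> Rx; exists 1.
have OE1 : (O `&` E) 1.
  by rewrite OW; split; [apply: WR; case: sR|case: sE].
have [N [nEN oN NO]] := smallN (O `&` E) (openI oO oE) OE1.
have [_ sN NE _] := nEN.
(* This is the image of [N]; each of its cosets passes through a point of [O ∩ E], hence belongs to
   [W]. *)
exists [set C : Q | exists2 y, val C y & N y]; split.
- apply: open_nbhs_nbhs; split; first exact: quotient_group_open_meet.
  by exists 1; [case: sR|case: sN].
- move=> C [y Cy /NO[z OEz [r Rr zy]]]; apply: WU.
  move: OEz; rewrite OW => -[[D WD Dz] _].
  suff -> : C = D by [].
  apply: quotient_group_eq Cy _.
  by rewrite (lcosetsE nER (quotient_groupP D) Dz); exists r.
- apply: normalizesP => [//|B C _ [y Cy Ny]].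
  have [b Eb Bb] := lcosets_neq0 nER (quotient_groupP B).
  exists (y ^ b); last exact: (is_normal_subgroupJ nEN).
  by exists b^-1; [exists b|exists (y * b) => //; exists y => //; exists b].
Qed.

End Quotient.

(** * The envelope [H * Res H * W] and its properties *)

Theorem theorem2 (G : topologicalGroupType) (H : set G) :
  hausdorff_space G -> totally_disconnected [set: G] ->
  locally_compact [set: G] ->
  is_subgroup H -> equicontinuously_generated H ->
  exists E : set G, open_subgroup E /\
    [/\ reduced_envelope H E,
        exists U : set G, [/\ open_subgroup U, compact U &
          E = set_mul (set_mul H (Res H)) U],
        equicontinuously_generated E /\
          (compactly_generated H -> compactly_generated E),
        Res H = \bigcap_(N in [set N | is_normal_subgroup E N /\ open N]) N &
        exists nER : is_normal_subgroup E (Res H),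
          SIN_group (quotient_group nER)].
Proof.
move=> hG tdG lcG sH eH.
have [U0 [oU0 cU0 _]] :=
  totally_disconnected_compact_open_subgroup hG tdG lcG (@filterT _ (nbhs (1 : G)) _).
have [W [oW cW _ nX]] := Res_mul_normalized hG tdG lcG sH eH oU0 cU0.
have [sW oW'] := oW; have sR := is_subgroup_Res H; have nR := normalizes_Res sH.
have nWR : normalizes W (Res H) by exact: normalizes_Res_compact.
have XE : set_mul (Res H) W = set_mul W (Res H) by rewrite set_mulC.
have sX : is_subgroup (set_mul (Res H) W) by rewrite XE; exact: is_subgroup_mul.
pose E := set_mul H (set_mul (Res H) W).
have sE : is_subgroup E by exact: is_subgroup_mul.
have oE : open E by do 2!apply: open_set_mul.
have HE : H `<=` E by apply: set_mul_subl; case: sX.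
have WE : W `<=` E.
  move=> w Ww; apply: set_mul_subr; first by case: sH.
  by apply: set_mul_subr => //; case: sR.
have RE : Res H `<=` E.
  move=> r Rr; apply: set_mul_subr; first by case: sH.
  by apply: set_mul_subl => //; case: sW.
have nE : normalizes E (Res H).
  apply: normalizes_mul => //; apply: normalizes_mul => //.
  exact: normalizes_self.
have nER : is_normal_subgroup E (Res H) by [].
(* The subgroup generated by [H] and [W] is open because it contains [W], and is normalized by [H],
   so it contains [Res H]. *)
have EHW : E = generated (H `|` W).
  apply/seteqP; split; last by apply: generated_sub => // x [/HE|/WE].
  have sHW := is_subgroup_generated (H `|` W).
  have HHW : H `<=` generated (H `|` W) by move=> x Hx; apply: sub_gen_smallest; left.
  have WHW : W `<=` generated (H `|` W) by move=> x Wx; apply: sub_gen_smallest; right.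
  do 2?[apply: set_mul_subgroup => //].
  apply: SubRes; last exact: normalizes_sub HHW (normalizes_self sHW).
  by apply: open_subgroupP => //; apply: filterS WHW (nbhs_open_subgroup oW).
(* This fact and [ResN] let open normal subgroups of [E] replace open [H]-invariant subgroups in the
   intersection defining [Res H]. *)
have normal_sub P : open_subgroup P -> normalizes H P ->
    exists N, [/\ is_normal_subgroup E N, open N & N `<=` P].
  exact: open_normal_subgroup_sub.
have ResN N : is_normal_subgroup E N -> open N -> Res H `<=` N.
  by move=> [_ sN _ nN] oN; apply: SubRes => //; exact: normalizes_sub nN.
exists E; split=> //; split.
- split=> // L oL fH; apply: (finite_index_envelope sH cW oL fH sE HE WE _ RE).
  (* Inverting [x^-1 = h * w * r] puts the [W]-factor before the [H]-factor; normality of [Res H] in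
     [E] then moves [r^-1] to the right. *)
  move=> x Ex; have : E x^-1 by exact: is_subgroupV.
  rewrite /E XE set_mulA => -[_ [h Hh [w Ww <-]] [r Rr /(congr1 (fun z => z^-1))]].
  rewrite !invgM invgK conjgC => <-.
  exists (w^-1 * h^-1); first by exists w^-1; [|exists h^-1]; rewrite //; exact: is_subgroupV.
  exists (r^-1 ^ (w^-1 * h^-1)) => //; apply: (normalizesJ nE); last exact: (is_subgroupV sR).
  by apply: is_subgroupM => //; apply: is_subgroupV => //; [exact: WE|exact: HE].
- by exists W; rewrite -set_mulA.
- split; first by rewrite EHW; exact: equicontinuously_generatedU.
  move=> [K cK HK]; exists (K `|` W); first exact: compactU.
  have sKW := is_subgroup_generated (K `|` W).
  rewrite EHW HK; apply/seteqP; split; apply: generated_sub => //.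
  - move=> x [|Wx]; last by apply: sub_gen_smallest; right.
    by move: x; apply: generated_sub => // x Kx; apply: sub_gen_smallest; left.
  - exact: is_subgroup_generated.
  - by move=> x [Kx|Wx]; apply: sub_gen_smallest; [left; exact: sub_gen_smallest|right].
- apply/seteqP; split=> [x Rx N [nEN oN]|x Nx P [oP nP]]; first exact: ResN Rx.
  by have [N [nEN oN NP]] := normal_sub _ oP nP; apply: NP; exact: Nx.
- exists nER; apply: quotient_group_SIN => //.
    move=> x nRx; apply: contrapT => nN; apply: nRx => P [oP nP].
    have [N [nEN oN NP]] := normal_sub _ oP nP; apply: NP.
    by apply: contrapT => nNx; apply: nN; exists N; split=> //; exact: ResN.
  move=> O oO O1.
  have [U [oU cU UO]] := totally_disconnected_compact_open_subgroup hG tdG lcG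
    (open_nbhs_nbhs (conj oO O1)).
  (* With [V] inside [O], [Res H * V] is an open [H]-invariant subgroup within [O * Res H]; an open
     normal subgroup of [E] inside it is small enough. *)
  have [V [oV cV VU nV]] := Res_mul_normalized hG tdG lcG sH eH oU cU.
  have [sV _] := oV; have nVR := normalizes_Res_compact sH sV cV nV.
  have VE : set_mul (Res H) V = set_mul V (Res H) by rewrite set_mulC.
  have [||N [nEN oN NV]] := normal_sub (set_mul (Res H) V) => //.
    split; first by rewrite VE; exact: is_subgroup_mul.
    by apply: open_set_mul; case: oV.
  exists N; split=> // x /NV; rewrite VE => -[v Vv [r Rr <-]].
  by exists v; [exact/UO/VU|exists r].
Qed.
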